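(* Let $\Omega$ be a basic set of an Axiom A diffeomorphism $f$. The Markov partition $\mathcal{R}=\{R_1,\dots,R_m\}$ of $\Omega$ constructed (as in the context) from the shadowing accuracy $\beta$ satisfies $$\max_i\mathrm{diam}(R_i)\le C\cdot\beta,$$ where $C$ depends on the geometry of $\Omega$.
   Context: A compact $f$-invariant set is hyperbolic if there is a continuous $Df$-invariant splitting $E^s\oplus E^u$ of the tangent bundle over it and constants $c>0,\lambda\in(0,1)$ with $\|Df^n_xv\|\le c\lambda^n\|v\|$ for $v\in E^s_x$ and $\|Df^{-n}_xv\|\le c\lambda^n\|v\|$ for $v\in E^u_x$, $n\ge0$. A $C^r$ diffeomorphism ($r\ge1$) of a compact Riemannian manifold $M$ satisfies Axiom A if its nonwandering set $\Omega(f)$ is hyperbolic and periodic points are dense in it. Basic sets are the members of the unique finite decomposition of $\Omega(f)$ into pairwise disjoint closed $f$-invariant sets on which $f$ is topologically transitive (each further being a finite disjoint union of closed sets cyclically permuted by $f$ on which the return power of $f$ is topologically mixing). $W^s_\varepsilon(x)=\{y: d(f^n(x),f^n(y))\le\varepsilon\ \forall n\ge0\}$, $W^u_\varepsilon(x)=\{y: d(f^{-n}(x),f^{-n}(y))\le\varepsilon\ \forall n\ge0\}$; a small local manifold size $\varepsilon$ and $\delta_0>0$ are fixed so that for $x,y\in\Omega$ with $d(x,y)<\delta_0$, $W^s_\varepsilon(x)\cap W^u_\varepsilon(y)$ is one point $[x,y]\in\Omega$. A rectangle is $R\subset\Omega$ with $\mathrm{diam}(R)<\delta_0$ and $[x,y]\in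 R$ for $x,y\in R$; $W^s(x,R)=W^s_\varepsilon(x)\cap R$, $W^u(x,R)=W^u_\varepsilon(x)\cap R$; $\partial^sR=\{x\in R:x\notin\mathrm{int}(W^u(x,R))\}$ and $\partial^uR=\{x\in R:x\notin\mathrm{int}(W^s(x,R))\}$ (interiors in $W^u_\varepsilon(x)\cap\Omega$, resp. $W^s_\varepsilon(x)\cap\Omega$). Construction. Let $\beta>0$ be small and let $\alpha>0$ be such that every bi-infinite sequence $(q_i)$ in $\Omega$ with $d(f(q_i),q_{i+1})<\alpha$ for all $i$ admits a unique $x\in\Omega$ with $d(f^i(x),q_i)\le\beta$ for all $i\in\mathbb{Z}$. Choose $\gamma<\alpha/2$ such that $d(f(x),f(y))<\alpha/2$ whenever $d(x,y)<\gamma$, and a finite $\gamma$-dense set $P=\{p_1,\dots,p_r\}\subset\Omega$. Let $\Sigma(P)=\{q\in P^{\mathbb{Z}}: d(f(q_i),q_{i+1})<\alpha\ \forall i\}$ and let $\theta(q)\in\Omega$ be the unique point with $d(f^i(\theta(q)),q_i)\le\beta$ for all $i$. Put $T_s=\{\theta(q):q\in\Sigma(P),q_0=p_s\}$, $1\le s\le r$; these are closed rectangles covering $\Omega$. For $x\in\Omega$ let $\mathcal{T}(x)=\{T_s:x\in T_s\}$ and $\mathcal{T}^*(x)=\{T_t: T_t\cap T_s\ne\emptyset\text{ for some }T_s\in\mathcal{T}(x)\}$, and let $Z^*$ be the (open dense) set of $x\in\Omega$ with $W^s_\varepsilon(x)\cap\partial^sT_t=\emptyset$ and $W^u_\varepsilon(x)\cap\partial^uT_t=\emptyset$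 for all $T_t\in\mathcal{T}^*(x)$. When $T_j\cap T_k\ne\emptyset$, partition $T_j$ into four sets $T^1_{j,k},T^2_{j,k},T^3_{j,k},T^4_{j,k}$ consisting of the $x\in T_j$ for which, respectively: both $W^u(x,T_j)$ and $W^s(x,T_j)$ meet $T_k$; only $W^u(x,T_j)$ meets $T_k$; only $W^s(x,T_j)$ meets $T_k$; neither meets $T_k$. For $x\in Z^*$ set $R(x)=\bigcap\{\mathrm{int}(T^n_{j,k}): x\in T_j,\ T_k\cap T_j\ne\emptyset,\ x\in T^n_{j,k}\}$ (interiors in $\Omega$). There are finitely many distinct sets $R(x)$, $x\in Z^*$; the Markov partition $\mathcal{R}$ consists of their closures $R_1,\dots,R_m$. *)

(* Defs.v *)
From HB Require Import structures.
From mathcomp Require Import all_boot all_order all_algebra.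
From mathcomp Require Import all_classical all_reals all_analysis.

Set Implicit Arguments.
Unset Strict Implicit.
Unset Printing Implicit Defensive.

Import Order.TTheory GRing.Theory Num.Theory.
Import numFieldNormedType.Exports.

Local Open Scope classical_set_scope.
Local Open Scope ring_scope.

Section smooth_maps.
Context {R : realType}.

(* [F] is of class C^k on the open set [U]: recursively, [F] is differentiable
   on [U] and its partial derivatives are of class C^(k-1). *)
Fixpoint class_C {n : nat} {W : normedModType R} (k : nat)
    (U : set 'rV[R]_n) (F : 'rV[R]_n -> W) : Prop :=
  if k is k'.+1 then
    (forall u, U u -> differentiable F u) /\
    (forall j : 'I_n, class_C k' U ('D_(delta_mx 0 j) F))
  else forall u, U u -> {for u, continuous F}.

End smooth_maps.

(* A C^oo structure of dimension [n] on [M].  A chart [i] is the homeomorphism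
   [coord i : dom i -> coord i @` dom i], with inverse [point i]; both are total
   functions, meaningful only on these open sets.  [chart_at x] is a chosen
   chart around [x]; it provides the coordinates in which tangent vectors
   at [x] are written. *)
Record smoothManifold (R : realType) (n : nat) (M : metricType R) :=
  SmoothManifold {
    chart : Type;
    dom : chart -> set M;
    coord : chart -> M -> 'rV[R]_n;
    point : chart -> 'rV[R]_n -> M;
    chart_at : M -> chart;
    dom_chart_at : forall x, dom (chart_at x) x;
    dom_open : forall i, open (dom i);
    coord_open : forall i, open (coord i @` dom i);
    coordK : forall i x, dom i x -> point i (coord i x) = x;
    coord_continuous : forall i x, dom i x -> {for x, continuous (coord i)};
    point_continuous : forall i x, dom i x ->
      {for coord i x, continuous (point i)};
    transition_smooth : forall i j k,
      class_C k (coord i @` (dom i `&` dom j)) (coord j \o point i)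
  }.

Section calculus_on_manifolds.
Context {R : realType} {n : nat} {M : metricType R}.
Variable G : smoothManifold n M.

(* The tangent space at [x] is ['rV[R]_n], through the chart [chart_at G x].
   Linear maps act on row vectors on the right, as Jacobian matrices do. *)

(* Passage from T_xM to coordinates in the chart [i]. *)
Definition dcoord (i : chart G) (x : M) : 'M[R]_n :=
  'J (coord i \o point (chart_at G x)) (coord (chart_at G x) x).

(* The differential T_xM -> T_{h x}M. *)
Definition dmap (h : M -> M) (x : M) : 'M[R]_n :=
  'J (coord (chart_at G (h x)) \o h \o point (chart_at G x))
    (coord (chart_at G x) x).

Definition class_C_map (r : nat) (h : M -> M) : Prop :=
  continuous h /\
  forall i j : chart G,
    class_C r (coord i @` (dom i `&` h @^-1` dom j)) (coord j \o h \o point i).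

(* [fi] is the inverse of the C^r diffeomorphism [f]. *)
Definition diffeomorphism (r : nat) (f fi : M -> M) : Prop :=
  [/\ cancel f fi, cancel fi f, class_C_map r f & class_C_map r fi].

Definition C1_curve (s : R -> M) : Prop :=
  continuous s /\
  forall (i : chart G) (t : R), dom i (s t) ->
    derivable (coord i \o s) t 1 /\ {for t, continuous (derive1 (coord i \o s))}.

Definition velocity (s : R -> M) (t : R) : 'rV[R]_n :=
  derive1 (coord (chart_at G (s t)) \o s) t.

(* A subbundle over [L] is a family of row spaces [E x] of T_xM.  It is
   continuous when it is locally spanned by continuous linearly independent
   vector fields. *)
Definition continuous_subbundle (L : set M) (E : M -> 'M[R]_n) : Prop :=
  forall x, L x -> exists (U : set M) (k : nat) (B : M -> 'M[R]_(k, n)),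
    [/\ open_nbhs x U, U `<=` dom (chart_at G x),
        {within L `&` U, continuous B} &
        forall y, (L `&` U) y ->
          row_free (B y) /\ (B y == E y *m dcoord (chart_at G x) y)%MS].

End calculus_on_manifolds.

Section riemannian.
Context {R : realType} {n : nat} {M : metricType R}.

(* Norm on T_xM of a field [g] of bilinear forms. *)
Definition form_norm (g : M -> 'M[R]_n) (x : M) (v : 'rV[R]_n) : R :=
  Num.sqrt ((v *m g x *m v^T) 0 0).

Definition curve_length (G : smoothManifold n M) (g : M -> 'M[R]_n)
    (s : R -> M) : \bar R :=
  (\int[lebesgue_measure]_(t in `[0%R, 1%R]) (form_norm g (s t) (velocity G s t))%:E)%E.

(* Curves of class C^1 give the same infimum as piecewise C^1 ones, since a
   corner can be reparametrized so that the velocity vanishes there. *)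
Definition curve_lengths (G : smoothManifold n M) (g : M -> 'M[R]_n)
    (x y : M) : set (\bar R) :=
  [set curve_length G g s | s in
    [set s : R -> M | [/\ C1_curve G s, s 0 = x & s 1 = y]]].

End riemannian.

(* The distance of [M] is the Riemannian one.  [M] need not be connected:
   between points that no curve joins, where the infimum is over the empty set,
   the distance is only required to be part of a metric defining the topology
   of [M]. *)
Record riemannianManifold (R : realType) (n : nat) (M : metricType R) :=
  RiemannianManifold {
    manifold :> smoothManifold n M;
    riem : M -> 'M[R]_n;
    riem_sym : forall x, (riem x)^T = riem x;
    riem_pos : forall x (v : 'rV[R]_n), v != 0 ->
      0 < (v *m riem x *m v^T) 0 0;
    riem_smooth : forall (i : chart manifold) (k : nat),
      class_C k (coord i @` dom i)
        (fun u => let x := point i u in let A := invmx (dcoord i x) in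
                  A *m riem x *m A^T);
    riem_dist : forall x y, curve_lengths manifold riem x y !=set0 ->
      (mdist x y)%:E = ereal_inf (curve_lengths manifold riem x y)
  }.

Section axiom_A.
Context {R : realType} {n : nat} {M : metricType R}.
Variables (G : riemannianManifold n M) (f fi : M -> M).

Let tnorm := form_norm (riem G).

Definition hyperbolic (L : set M) : Prop :=
  [/\ compact L, f @` L = L &
   exists (Es Eu : M -> 'M[R]_n) (c lam : R),
   [/\ continuous_subbundle G L Es /\ continuous_subbundle G L Eu,
       forall x, L x -> (Es x + Eu x == 1%:M)%MS /\ (Es x :&: Eu x = 0)%MS,
       forall x, L x -> (Es x *m dmap G f x == Es (f x))%MS /\
                        (Eu x *m dmap G f x == Eu (f x))%MS,
       0 < c /\ 0 < lam < 1 &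
       forall x, L x -> forall (v : 'rV[R]_n) (k : nat),
         ((v <= Es x)%MS ->
            tnorm (iter k f x) (v *m dmap G (iter k f) x)
              <= c * lam ^+ k * tnorm x v) /\
         ((v <= Eu x)%MS ->
            tnorm (iter k fi x) (v *m dmap G (iter k fi) x)
              <= c * lam ^+ k * tnorm x v)]].

Definition nonwandering : set M :=
  [set x | forall U, nbhs x U ->
     exists2 k, (0 < k)%N & (iter k f @` U) `&` U !=set0].

Definition periodic_points : set M :=
  [set x | exists2 k, (0 < k)%N & iter k f x = x].

Definition axiomA : Prop :=
  hyperbolic nonwandering /\ nonwandering `<=` closure periodic_points.

End axiom_A.

Section basic_sets.
Context {R : realType} {M : metricType R}.
Implicit Types (f h : M -> M) (X : set M).

Definition topologically_transitive h X : Prop :=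
  forall U V, open U -> open V -> X `&` U !=set0 -> X `&` V !=set0 ->
    exists k, (iter k h @` (X `&` U)) `&` (X `&` V) !=set0.

Definition topologically_mixing h X : Prop :=
  forall U V, open U -> open V -> X `&` U !=set0 -> X `&` V !=set0 ->
    exists N, forall k, (N <= k)%N ->
      (iter k h @` (X `&` U)) `&` (X `&` V) !=set0.

Definition cyclic_mixing_decomposition f X : Prop :=
  exists (N : nat) (Y : nat -> set M),
    [/\ (0 < N)%N, X = \bigcup_(i in `I_N) Y i, trivIset `I_N Y,
        forall i, (i < N)%N -> closed (Y i) &
        forall i, (i < N)%N -> f @` Y i = Y (i.+1 %% N)%N /\
                               topologically_mixing (iter N f) (Y i)].

Definition spectral_decomposition f (S : set (set M)) : Prop :=
  [/\ finite_set S, trivIset S id, \bigcup_(X in S) X = nonwandering f &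
      forall X, S X -> X !=set0 /\
        [/\ closed X, f @` X = X, topologically_transitive f X &
            cyclic_mixing_decomposition f X]].

Definition basic_set f X : Prop :=
  exists2 S, spectral_decomposition f S & S X.

End basic_sets.

Section local_product_structure.
Context {R : realType} {M : metricType R}.
Variables (f fi : M -> M) (Omega : set M) (eps : R).

Definition Ws (x : M) : set M :=
  [set y | forall k, mdist (iter k f x) (iter k f y) <= eps].

Definition Wu (x : M) : set M :=
  [set y | forall k, mdist (iter k fi x) (iter k fi y) <= eps].

Definition canonical_coordinates (delta0 : R) : Prop :=
  forall x y, Omega x -> Omega y -> mdist x y < delta0 ->
    exists2 z, Omega z & Ws x `&` Wu y = [set z].

Definition relative_interior (Y A : set M) : set M :=
  [set x | Y x /\ within Y (nbhs x) A].

Definition boundary_s (A : set M) : set M :=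
  [set x | A x /\ ~ relative_interior (Wu x `&` Omega) (Wu x `&` A) x].

Definition boundary_u (A : set M) : set M :=
  [set x | A x /\ ~ relative_interior (Ws x `&` Omega) (Ws x `&` A) x].

End local_product_structure.

Section shadowing.
Context {R : realType} {M : metricType R}.
Variables (f fi : M -> M) (Omega : set M).

(* f^i for [i : int]. *)
Definition iterz (i : int) : M -> M :=
  match i with Posz k => iter k f | Negz k => iter k.+1 fi end.

Definition pseudo_orbit (alpha : R) (q : int -> M) : Prop :=
  forall i : int, mdist (f (q i)) (q (i + 1)) < alpha.

Definition shadows (beta : R) (x : M) (q : int -> M) : Prop :=
  forall i : int, mdist (iterz i x) (q i) <= beta.

Definition unique_shadowing (alpha beta : R) : Prop :=
  forall q : int -> M, (forall i, Omega (q i)) -> pseudo_orbit alpha q ->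
    exists! x, Omega x /\ shadows beta x q.

Definition Sigma (N : nat) (p : 'I_N -> M) (alpha : R) : set (int -> M) :=
  [set q | (forall i, range p (q i)) /\ pseudo_orbit alpha q].

End shadowing.

Section markov_partition.
Context {R : realType} {M : metricType R}.
Variables (f fi : M -> M) (Omega : set M) (eps alpha : R).
Variables (N : nat) (p : 'I_N -> M) (theta : (int -> M) -> M).

Definition T (s : 'I_N) : set M :=
  theta @` [set q | Sigma f p alpha q /\ q 0 = p s].

(* Indices [t] of the members of T^*(x). *)
Definition Tstar (x : M) : set 'I_N :=
  [set t | exists2 s, T s x & T t `&` T s !=set0].

Definition Zstar : set M :=
  [set x | Omega x /\ forall t, Tstar x t ->
     Ws f eps x `&` boundary_s fi Omega eps (T t) = set0 /\
     Wu fi eps x `&` boundary_u f Omega eps (T t) = set0].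

(* The four parts T^1, ..., T^4 of [T j] with respect to [T k], numbered
   from 0. *)
Definition Tpart (j k : 'I_N) (m : 'I_4) : set M :=
  [set x | T j x /\
     let u := (Wu fi eps x `&` T j) `&` T k !=set0 in
     let s := (Ws f eps x `&` T j) `&` T k !=set0 in
     match val m with
     | 0%N => u /\ s
     | 1%N => u /\ ~ s
     | 2%N => ~ u /\ s
     | _ => ~ u /\ ~ s
     end].

Definition Rcell (x : M) : set M :=
  \bigcap_(a in [set a : 'I_N * 'I_N * 'I_4 |
      [/\ T a.1.1 x, T a.1.2 `&` T a.1.1 !=set0 & Tpart a.1.1 a.1.2 a.2 x]])
    relative_interior Omega (Tpart a.1.1 a.1.2 a.2).

Definition markov_partition : set (set M) :=
  [set closure (Rcell x) | x in Zstar].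

End markov_partition.

Section diameter.
Context {R : realType} {M : metricType R}.

Definition diam (A : set M) : \bar R :=
  ereal_sup [set (mdist z.1 z.2)%:E | z in A `*` A].

(* For a finite family the supremum is the maximum. *)
Definition max_diam (P : set (set M)) : \bar R := ereal_sup (diam @` P).

End diameter.

(* Main.v *)
Require Import Defs.
From HB Require Import structures.
From mathcomp Require Import all_boot all_order all_algebra.
From mathcomp Require Import all_classical all_reals all_analysis.
From mathcomp Require Import zify lra.

Set Implicit Arguments.
Unset Strict Implicit.
Unset Printing Implicit Defensive.

Import Order.TTheory GRing.Theory Num.Theory.
Import numFieldNormedType.Exports.

Local Open Scope classical_set_scope.
Local Open Scope ring_scope.

(** Every member of the Markov partition lies in the closure of one of the
    rectangles [T s], and each [T s] has diameter at most [2 * beta] because all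
    its points shadow, at time 0, the same point [p s]: hence [C = 2] works for
    every basic set.  A cell [Rcell x] is contained in [T j] as soon as [x] is
    in [T j], for [x] then belongs to the first of the four parts of [T j] with
    respect to [T j] itself ([Rcell_sub_T]).

    What has to be proved is therefore that the [T s] cover [Omega]
    ([T_cover]).  Given [x], choose [p (s i)] within [gamma] of the [i]-th
    iterate of [x]; these points form an [alpha]-pseudo-orbit [q].  If
    [gamma]-closeness implies [beta]-closeness, then [x] shadows [q], and
    [theta q = x] by uniqueness of shadowing.  No inequality between [gamma]
    and [beta] is assumed, but the implication follows from the shadowing
    property ([close_points_beta_close]): replacing the point at time 0 of the
    orbit of [x] by a point [y] that is [gamma]-close to [x] yields a
    pseudo-orbit; the point [z] that shadows it stays [beta]-close to the orbit
    of [x] at all nonzero times, hence [eps]-close at all times once [beta] is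
    small with respect to the modulus of continuity of the inverse of [f].
    Expansivity, which is contained in the existence of canonical coordinates
    ([expansive]), gives [z = x], so that [y] is [beta]-close to [x]. *)

Lemma compact_uniformly_continuous (R : realType) (M : metricType R)
    (h : M -> M) (e : R) :
  compact [set: M] -> continuous h -> 0 < e ->
  exists2 d, 0 < d & forall x y, mdist x y < d -> mdist (h x) (h y) <= e.
Proof.
move=> /compact_near_coveringP cM hcont e0.
pose P (d : R) (x : M) := forall y, mdist x y < d -> mdist (h x) (h y) <= e.
suff [d d0 Pd] : exists2 d, 0 < d & [set: M] `<=` P d.
  by exists d => // x y; exact: Pd.
have : \forall d \near 0^'+, [set: M] `<=` P d.
  apply: cM => x _.
  have /nbhs_ballP[r /= r0 hr] : nbhs x (h @^-1` ball (h x) (e / 2)).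
    by apply: hcont; apply: nbhsx_ballx; rewrite divr_gt0.
  have r20 : 0 < r / 2 by rewrite divr_gt0.
  exists (ball x (r / 2), [set d | d < r / 2]).
    by split => /=; [exact: nbhsx_ballx | exact: nbhs_right_lt].
  move=> [x' d] /= [xx' dr] y x'y.
  have x'yr : ball x' (r / 2) y.
    by rewrite ballEmdist /=; exact: lt_trans dr.
  have hx' : ball (h x) (e / 2) (h x').
    by apply: hr; apply: le_ball xx'; rewrite ler_pdivrMr// ler_pMr// ler1n.
  have hy : ball (h x) (e / 2) (h y).
    by apply: hr; have := ball_triangle xx' x'yr; rewrite -splitr.
  have := ball_triangle (ball_sym hx') hy.
  by rewrite -splitr ballEmdist /=; exact: ltW.
move=> near_P.
by have [d [d0 Pd]] := filter_ex (filterI (nbhs_right_gt 0) near_P); exists d.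
Qed.

Lemma closure_mdist_le (R : realType) (M : metricType R) (A : set M) (D : R) :
  (forall a b, A a -> A b -> mdist a b <= D) ->
  forall a b, closure A a -> closure A b -> mdist a b <= D.
Proof.
move=> AD a b Aa Ab; apply/ler_addgt0Pl => e e0.
have e20 : 0 < e / 2 by rewrite divr_gt0.
have [a' [Aa' aa']] := Aa _ (nbhsx_ballx a _ e20).
have [b' [Ab' bb']] := Ab _ (nbhsx_ballx b _ e20).
rewrite ballEmdist /= in aa'; rewrite ballEmdist /= metric_sym in bb'.
have := AD _ _ Aa' Ab'.
have := metric_triangle a a' b; have := metric_triangle a' b' b.
lra.
Qed.

Lemma iterzS (R : realType) (M : metricType R) (f fi : M -> M) (i : int) (x : M) :
  cancel fi f -> iterz f fi (i + 1) x = f (iterz f fi i x).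
Proof.
move=> fiK; case: i => [k|[|k]].
- by rewrite addrC -intS.
- by rewrite /= fiK.
- have -> : Negz k.+1 + 1 = Negz k by rewrite !NegzE; lia.
  by rewrite /= fiK.
Qed.

Lemma iterz_stable (R : realType) (M : metricType R) (f fi : M -> M)
    (Omega : set M) (i : int) (x : M) :
  cancel f fi -> f @` Omega = Omega -> Omega x -> Omega (iterz f fi i x).
Proof.
move=> fK fO Ox.
have Of y : Omega y -> Omega (f y) by move=> Oy; rewrite -fO; exists y.
have Ofi y : Omega y -> Omega (fi y).
  by rewrite -{1}fO => -[w Ow <-]; rewrite fK.
case: i => k; first by elim: k => [|k] //= /Of.
by apply: (Ofi (iter k fi x)); elim: k => [|k] //= /Ofi.
Qed.

(** The local manifolds [Ws x] and [Wu x] meet in a single point; both [x] and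
    any point whose full orbit stays [eps]-close to that of [x] lie in this
    intersection. *)
Lemma expansive (R : realType) (M : metricType R) (f fi : M -> M)
    (Omega : set M) (eps delta0 : R) (x z : M) :
  0 < eps -> 0 < delta0 -> canonical_coordinates f fi Omega eps delta0 ->
  Omega x -> (forall i, mdist (iterz f fi i x) (iterz f fi i z) <= eps) ->
  z = x.
Proof.
move=> eps0 del0 cc Ox xz.
have [|w _ E] := cc x x Ox Ox; first by rewrite mdistxx.
have -> : x = w.
  have : [set w] x by rewrite -E; split => k /=; rewrite mdistxx ltW.
  by [].
have : [set w] z.
  rewrite -E; split => k /=; first exact: (xz (Posz k)).
  by case: k => [|k]; [exact: (xz 0) | exact: (xz (Negz k))].
by [].
Qed.

(** The orbit of [x], with the point at time 0 replaced by [y], is a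
    pseudo-orbit that no point other than [x] can shadow, so the shadowing
    accuracy bounds how far [y] can be from [x]. *)
Lemma close_points_beta_close (R : realType) (M : metricType R)
    (f fi : M -> M) (Omega : set M) (eps delta0 alpha beta : R) (x y : M) :
  cancel f fi -> cancel fi f -> f @` Omega = Omega ->
  0 < eps -> 0 < delta0 -> canonical_coordinates f fi Omega eps delta0 ->
  beta <= eps ->
  (forall a b, mdist a b <= beta -> mdist (fi a) (fi b) <= eps) ->
  0 < alpha -> unique_shadowing f fi Omega alpha beta ->
  Omega x -> Omega y -> mdist x y < alpha -> mdist (f x) (f y) < alpha ->
  mdist x y <= beta.
Proof.
move=> fK fiK fO eps0 del0 cc beps fib al0 us Ox Oy xy fxy.
pose q (i : int) := if i == 0 then y else iterz f fi i x.
have [|i|z [[_ zq] _]] := us q.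
- by move=> i; rewrite /q; case: ifP => // _; exact: iterz_stable.
- rewrite /q; have [->|i0] := eqVneq i 0; first by rewrite /= metric_sym.
  rewrite -iterzS//; have [->|_] := eqVneq (i + 1) 0; first by [].
  by rewrite mdistxx.
have zx (i : int) : i != 0 ->
    mdist (iterz f fi i x) (iterz f fi i z) <= beta.
  by move=> i0; have := zq i; rewrite /q (negbTE i0) metric_sym.
have -> : x = z.
  apply/esym/(expansive eps0 del0 cc Ox) => i.
  have [->|i0] := eqVneq i 0; last exact: le_trans (zx i i0) beps.
  (* Time 0 is the image of time 1 under the inverse of [f]. *)
  by have := fib _ _ (zx 1 isT); rewrite /= !fK.
by have := zq 0; rewrite /q eqxx.
Qed.

Lemma T_cover (R : realType) (M : metricType R)
    (f fi : M -> M) (Omega : set M) (alpha beta gamma : R)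
    (N : nat) (p : 'I_N -> M) (theta : (int -> M) -> M) :
  cancel f fi -> cancel fi f -> f @` Omega = Omega ->
  gamma < alpha / 2 -> unique_shadowing f fi Omega alpha beta ->
  (forall x y, Omega x -> Omega y -> mdist x y < gamma ->
     mdist (f x) (f y) < alpha / 2) ->
  (forall x y, Omega x -> Omega y -> mdist x y < gamma ->
     mdist x y <= beta) ->
  (forall s, Omega (p s)) ->
  (forall x, Omega x -> exists s, mdist x (p s) < gamma) ->
  (forall q, Sigma f p alpha q ->
     Omega (theta q) /\ shadows f fi beta (theta q) q) ->
  forall x, Omega x -> exists s, T f alpha p theta s x.
Proof.
move=> fK fiK fO ga us fg gb Op pdense thetaP x Ox.
have Oi i : Omega (iterz f fi i x) by exact: iterz_stable.
have [s sP] := choice (fun i => pdense _ (Oi i)).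
pose q i := p (s i).
have qpo : pseudo_orbit f alpha q.
  move=> i; apply: le_lt_trans (metric_triangle _ (iterz f fi (i + 1) x) _) _.
  rewrite [ltRHS]splitr ltrD//; last exact: lt_trans (sP _) ga.
  by rewrite iterzS// metric_sym; exact: fg (Oi i) (Op (s i)) (sP i).
have qS : Sigma f p alpha q by split => // i; exists (s i).
have [w [_ wuniq]] := us q (fun i => Op (s i)) qpo.
have xw : w = x by apply: wuniq; split => // i; exact: gb (Oi i) (Op (s i)) (sP i).
exists (s 0), q => //.
by rewrite -xw; apply/esym/wuniq; exact: thetaP.
Qed.

Lemma T_diam (R : realType) (M : metricType R) (f fi : M -> M) (Omega : set M)
    (alpha beta : R) (N : nat) (p : 'I_N -> M) (theta : (int -> M) -> M) s :
  (forall q, Sigma f p alpha q ->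
     Omega (theta q) /\ shadows f fi beta (theta q) q) ->
  forall a b, T f alpha p theta s a -> T f alpha p theta s b ->
  mdist a b <= 2 * beta.
Proof.
move=> thetaP _ _ [q [qS q0] <-] [q' [qS' q0'] <-].
have /(_ 0) := (thetaP _ qS).2; have /(_ 0) := (thetaP _ qS').2.
rewrite /= q0 q0' (metric_sym (theta q')) => h' h.
by apply: le_trans (metric_triangle _ (p s) _) _; rewrite mulr2n mulrDl mul1r lerD.
Qed.

(** The pair of [T j] with itself is among those that define the cell, and [x]
    then witnesses that both its local manifolds meet [T j]. *)
Lemma Rcell_sub_T (R : realType) (M : metricType R) (f fi : M -> M)
    (Omega : set M) (eps alpha : R) (N : nat) (p : 'I_N -> M)
    (theta : (int -> M) -> M) (j : 'I_N) (x : M) :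
  0 <= eps -> T f alpha p theta j x ->
  Rcell f fi Omega eps alpha p theta x `<=` T f alpha p theta j.
Proof.
move=> eps0 Tx y /(_ (j, j, ord0)) /= [].
  split => //; first by exists x.
  by split=> //; split; exists x; split=> //; split=> // k /=; rewrite mdistxx.
by move=> Oy /nbhs_singleton /(_ Oy) [].
Qed.

Theorem proposition8p11 (R : realType) (n : nat) (M : metricType R)
    (G : riemannianManifold n M) (r : nat) (f fi : M -> M) (Omega : set M) :
  compact [set: M] ->
  (1 <= r)%N -> diffeomorphism G r f fi ->
  axiomA G f fi -> basic_set f Omega ->
  exists2 C : R, 0 < C &
  forall eps delta0 : R, 0 < eps -> 0 < delta0 ->
  canonical_coordinates f fi Omega eps delta0 ->
  exists2 beta0 : R, 0 < beta0 &
  forall beta alpha gamma : R,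
  0 < beta < beta0 ->
  0 < alpha -> unique_shadowing f fi Omega alpha beta ->
  0 < gamma < alpha / 2 ->
  (forall x y, Omega x -> Omega y ->
     mdist x y < gamma -> mdist (f x) (f y) < alpha / 2) ->
  forall (N : nat) (p : 'I_N -> M),
  (forall s, Omega (p s)) ->
  (forall x, Omega x -> exists s, mdist x (p s) < gamma) ->
  forall theta : (int -> M) -> M,
  (forall q, Sigma f p alpha q ->
     Omega (theta q) /\ shadows f fi beta (theta q) q) ->
  (max_diam (markov_partition f fi Omega eps alpha p theta)
     <= (C * beta)%:E)%E.
Proof.
move=> cM _ [fK fiK _ [fi_cont _]] _ [S [_ _ _ SP] SO].
have [_ [_ fO _ _]] := SP _ SO.
exists 2 => // eps delta0 eps0 del0 cc.
have [d d0 fid] := compact_uniformly_continuous cM fi_cont eps0.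
exists (Num.min eps d); first by rewrite lt_min eps0.
move=> beta alpha gamma /andP[_]; rewrite lt_min => /andP[beps bd] al0 us.
move=> /andP[_ ga] fg N p Op pdense theta thetaP.
have al2 : alpha / 2 < alpha by rewrite ltr_pdivrMr// ltr_pMr// ltr1n.
apply: ge_ereal_sup => _ [_ [x [Ox _] <-] <-].
apply: ge_ereal_sup => _ [[a b] [/= ca cb] <-]; rewrite lee_fin.
have [y z Oy Oz yz|s Tx] := T_cover fK fiK fO ga us fg _ Op pdense thetaP Ox.
  apply: (close_points_beta_close fK fiK fO eps0 del0 cc (ltW beps) _ al0 us) => //.
  - by move=> ? ? /le_lt_trans/(_ bd); exact: fid.
  - exact: lt_trans yz (lt_trans ga al2).
  - exact: lt_trans (fg _ _ Oy Oz yz) al2.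
move: a b ca cb; apply: closure_mdist_le => a b.
move=> /(Rcell_sub_T (ltW eps0) Tx) Ta /(Rcell_sub_T (ltW eps0) Tx).
exact: T_diam thetaP _ _ Ta.
Qed.
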